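(* Let $T_{k,h}$ be the unweighted, complete $k$-ary tree of height $h$ (with $k,h\in\mathbb N$), equipped with its shortest-path metric. For every $\varepsilon>0$, there exists a $(1+\varepsilon)$-embedding of $T_{k,h}$ into $\ell_1^{O((h\log k)/\varepsilon^2)}$.
   Context: $T_{k,h}$ is the rooted tree in which every vertex at distance less than $h$ from the root has exactly $k$ children and every vertex at distance $h$ from the root is a leaf; all edges have length $1$. $\ell_1^d$ denotes $\mathbb R^d$ with the norm $\|\cdot\|_1$; the $O(\cdot)$ in the dimension hides a universal constant. For $f:(X,d_X)\to(Y,d_Y)$, $\|f\|_{\mathrm{Lip}}=\sup_{x\ne y}\frac{d_Y(f(x),f(y))}{d_X(x,y)}$, and the distortion of $f$ is $\|f\|_{\mathrm{Lip}}\cdot\|f^{-1}\|_{\mathrm{Lip}}$ (infinite if $f$ is not injective). A $D$-embedding is a map with distortion at most $D$.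
   Formalization: The dimension bound is read as at most max(1, C·h·log k / min(1,ε)²) with C universal: dimension 1 is always allowed (needed for k = 1, where log k = 0), and ε > 1 gets the bound for ε = 1, since the literal bound fails for large ε. *)

(* Defs.v *)
From HB Require Import structures.
From mathcomp Require Import all_boot all_order all_algebra.
From mathcomp Require Import all_classical all_reals all_analysis.
Set Implicit Arguments.
Unset Strict Implicit.
Unset Printing Implicit Defensive.
Import Order.TTheory GRing.Theory Num.Theory.
Local Open Scope classical_set_scope.
Local Open Scope ring_scope.

Section GraphMetric.
Variables (V : finType) (e : rel V).

Definition has_path_of_length (x y : V) (n : nat) : bool :=
  [exists p : n.-tuple V, path e x p && (last x p == y)].

Lemma connect_has_path x y :
  connect e x y -> exists n, has_path_of_length x y n.
Proof.
move=> /connectP[p pP ->]; exists (size p).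
by apply/existsP; exists (in_tuple p); rewrite pP eqxx.
Qed.

Definition path_dist (e_connected : forall x y, connect e x y) (x y : V) : nat :=
  ex_minn (connect_has_path (e_connected x y)).

End GraphMetric.

Section CompleteTree.
Variables k h : nat.

(* A vertex is the sequence of child labels read along the path from the root
   (the empty sequence) down to it; its length is its depth. *)
Definition tree : Type := h.-bseq 'I_k.

HB.instance Definition _ := Finite.on tree.
HB.instance Definition _ := isPointed.Build tree (nil_bseq h 'I_k).

Definition is_child (u v : tree) : bool :=
  [exists a : 'I_k, rcons (bseqval u) a == bseqval v].

Definition tree_adj : rel tree := [rel u v | is_child u v || is_child v u].

Lemma tree_adj_sym : symmetric tree_adj.
Proof. by move=> u v; rewrite /tree_adj /= orbC. Qed.

Lemma tree_connect_root (v : tree) : connect tree_adj (nil_bseq h 'I_k) v.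
Proof.
case: v => s; elim/last_ind: s => [|s a IH] sh.
  by rewrite (_ : Bseq sh = nil_bseq h 'I_k) //; apply: val_inj.
have sh' : (size s <= h)%N by rewrite size_rcons in sh; exact: ltnW.
apply: connect_trans (IH sh') _; apply: connect1.
by apply/orP; left; apply/existsP; exists a.
Qed.

Lemma tree_connected (u v : tree) : connect tree_adj u v.
Proof.
apply: (@connect_trans _ _ (nil_bseq h 'I_k)); last exact: tree_connect_root.
by rewrite (sym_connect_sym tree_adj_sym) tree_connect_root.
Qed.

Definition tree_dist : tree -> tree -> nat := path_dist tree_connected.

End CompleteTree.

Section Embeddings.
Variable R : realType.

Definition l1_dist (d : nat) (x y : 'rV[R]_d) : R :=
  \sum_(i < d) `|x 0 i - y 0 i|.

(* The singleton of 0 only matters when A has at most one point: the supremum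
   of nonnegative ratios over the empty set is 0, whereas ereal_sup gives -oo. *)
Definition lip_norm (X Y : Type) (dX : X -> X -> R) (dY : Y -> Y -> R)
    (A : set X) (f : X -> Y) : \bar R :=
  ereal_sup ([set 0%E] `|` [set r | exists x y,
    [/\ A x, A y, x <> y & r = (dY (f x) (f y) / dX x y)%:E]]).

Definition distortion (X : pointedType) (Y : choiceType)
    (dX : X -> X -> R) (dY : Y -> Y -> R) (f : X -> Y) : \bar R :=
  if `[< injective f >] then
    (lip_norm dX dY setT f * lip_norm dY dX (range f) (pinv setT f))%E
  else +oo%E.

Definition is_embedding (X : pointedType) (Y : choiceType)
    (dX : X -> X -> R) (dY : Y -> Y -> R) (D : R) (f : X -> Y) : Prop :=
  (distortion dX dY f <= D%:E)%E.

(* The bound O((h log k) / eps^2) is an asymptotic one: read verbatim it gives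
   dimension 0 for a path (k = 1, h > 0) and, for fixed k and h, as soon as eps
   is large.  The inner minimum is inert for eps <= 1 and makes larger eps
   inherit the bound of eps = 1; the outer maximum allows dimension 1, and is
   absorbed by C unless h = 0 or k <= 1. *)
Definition dim_bound (C : R) (k h : nat) (eps : R) : R :=
  Num.max 1 (C * (h%:R * ln k%:R / Num.min 1 eps ^+ 2)).

End Embeddings.

(* Main.v *)
(* Label the edge entering a vertex w of depth n by
     A_{n-1}(w_1) + A_{n-2}(w_2) + ... + A_0(w_n),
   where the A_i map 'I_k to (Z/qZ)^t, and let w have, at each level, the
   concatenated one-hot encodings of the t entries of its label there.  If the
   paths to u and v split below p, the l1 distance of their images is t times the
   tree distance minus twice the number of entries in which the labels of the two
   branches agree, so it suffices that at most a fraction of order eps of these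
   entries agree.

   Because labels depend on the A_i in a convolutional (Toeplitz) way, agreements
   do not depend on p, and one may assume that the first letters of the branches
   differ.  Then A_n enters the difference of labels at depth n + 1 through
   A_n(x) - A_n(y) with x <> y, which is uniform when A_n is.  Choosing A_0, A_1,
   ... one after the other by averaging, as in the method of conditional
   expectations, the potential (sum over pairs of branches of length n of 2 to the
   number of agreements) grows at each step by a factor of at most
   k^2 (1 + 1/q)^t.  This takes the place of the Lovasz local lemma, and
   t ~ log k / eps, q ~ 1 / eps suffice. *)
Require Import Defs.
From HB Require Import structures.
From mathcomp Require Import all_boot all_order all_algebra.
From mathcomp Require Import all_classical all_reals all_analysis.
From mathcomp Require Import ring lra zify.
Set Implicit Arguments.
Unset Strict Implicit.
Unset Printing Implicit Defensive.
Import Order.TTheory GRing.Theory Num.Theory.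
Local Open Scope ring_scope.

(** * Common prefixes, convolutional labels and agreements *)

(** The empty sequence is accepted: it is the [zip] of the two branches when one vertex is an
    ancestor of the other. *)
Definition pairs_differ (T : eqType) (s : seq (T * T)) : bool :=
  if s is a :: _ then a.1 != a.2 else true.

Lemma pairs_differ_rcons (T : eqType) (s : seq (T * T)) a :
  pairs_differ (rcons s a) -> pairs_differ s.
Proof. by case: s. Qed.

Lemma common_prefix (T : eqType) (u v : seq T) :
  exists p w w', [/\ u = p ++ w, v = p ++ w' & pairs_differ (zip w w')].
Proof.
elim: u v => [|x u IH] [|y v]; first by exists [::], [::], [::].
- by exists [::], [::], (y :: v).
- by exists [::], (x :: u), [::].
have [<-|xy] := eqVneq x y.
  by have [p [w [w' [-> -> ww']]]] := IH v; exists (x :: p), w, w'.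
by exists [::], (x :: u), (y :: v).
Qed.

(* The first letter of [w] is the only one that meets [A (size w).-1]. *)
Fixpoint label (T : Type) (G : zmodType) (A : nat -> T -> G) (w : seq T) : G :=
  if w is x :: w' then A (size w') x + label A w' else 0.

(** The index of the map that a letter meets is the number of letters after it. With tails of equal
    length, a letter of [p] therefore contributes the same term to both labels, and it cancels. *)
Lemma label_cat_sub (T : Type) (G : zmodType) (A : nat -> T -> G) p w w' :
  size w = size w' ->
  label A (p ++ w) - label A (p ++ w') = label A w - label A w'.
Proof.
move=> ww'; elim: p => //= x p IH.
by rewrite !size_cat ww' opprD addrACA subrr add0r.
Qed.

Lemma eq_label (T : Type) (G : zmodType) (A B : nat -> T -> G) (w : seq T) :
  (forall i, (i < size w)%N -> A i = B i) -> label A w = label B w.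
Proof.
elim: w => //= x w IH AB; rewrite AB // IH // => i iw.
by apply: AB; apply: ltnW.
Qed.

Definition label_diff (T : Type) (G : zmodType) (A : nat -> T -> G)
  (s : seq (T * T)) : G := label A (unzip1 s) - label A (unzip2 s).

Lemma label_diff_cons (T : Type) (G : zmodType) (A : nat -> T -> G) a s :
  label_diff A (a :: s) = A (size s) a.1 - A (size s) a.2 + label_diff A s.
Proof. by rewrite /label_diff /= !size_map opprD addrACA. Qed.

Lemma eq_label_diff (T : Type) (G : zmodType) (A B : nat -> T -> G) s :
  (forall i, (i < size s)%N -> A i = B i) -> label_diff A s = label_diff B s.
Proof.
move=> AB; rewrite /label_diff.
by congr (_ - _); apply: eq_label; rewrite size_map.
Qed.

Definition zeros (t q : nat) (v : {ffun 'I_t -> 'I_q.+1}) : nat :=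
  #|[set b | v b == 0]|.

(** Each nonempty prefix of [s] stands for two edges at the same level, one on each branch; a zero
    of its [label_diff] is an entry in which their labels coincide. *)
Definition agreements (T : Type) (t q : nat)
    (A : nat -> T -> {ffun 'I_t -> 'I_q.+1}) (s : seq (T * T)) : nat :=
  (\sum_(i < size s) zeros (label_diff A (take i.+1 s)))%N.

Lemma agreements_rcons (T : Type) (t q : nat)
    (A : nat -> T -> {ffun 'I_t -> 'I_q.+1}) s a :
  agreements A (rcons s a) =
    (agreements A s + zeros (label_diff A (rcons s a)))%N.
Proof.
rewrite /agreements size_rcons big_ord_recr /= take_oversize ?size_rcons //.
congr addn; apply: eq_bigr => i _.
by rewrite -cats1 takel_cat.
Qed.

Lemma eq_agreements (T : Type) (t q : nat)
    (A B : nat -> T -> {ffun 'I_t -> 'I_q.+1}) s :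
  (forall i, (i < size s)%N -> A i = B i) -> agreements A s = agreements B s.
Proof.
move=> AB; apply: eq_bigr => i _; congr zeros; apply: eq_label_diff => j.
by rewrite size_takel // => ji; apply: AB; apply: leq_trans ji _.
Qed.

(** * Averages of the exponential weight *)

(** The weight is a product over the [t] entries, and each entry sums to 2 for the value 0 plus 1
    for each of the [q] other values. *)
Lemma sum_exp_zeros (t q : nat) :
  (\sum_(v : {ffun 'I_t -> 'I_q.+1}) 2 ^ zeros v = q.+2 ^ t)%N.
Proof.
pose w (g : 'I_q.+1) := (if g == 0%R then 2 else 1)%N.
have -> : (q.+2 ^ t = \prod_(b < t) \sum_(g : 'I_q.+1) w g)%N.
  rewrite (eq_bigr (fun=> q.+2)) ?prod_nat_const ?card_ord // => b _.
  rewrite (bigD1 0) //= /w eqxx (eq_bigr (fun=> 1%N)) => [|g /negbTE-> //].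
  by rewrite sum1_card cardC1 card_ord.
rewrite bigA_distr_bigA; apply: eq_bigr => v _.
rewrite /zeros -prod_nat_const [RHS]big_mkcond [LHS]big_mkcond /=.
by apply: eq_bigr => b _; rewrite inE /w.
Qed.

(* Translating [B x] by [v] permutes the functions [B] and turns the argument
   into [B x - B y + c + v]; summing over [v] makes it uniform. *)
Lemma sum_exp_zeros_shift (T : finType) (t q : nat) (x y : T)
    (c : {ffun 'I_t -> 'I_q.+1}) :
  x != y ->
  (q.+1 ^ t * \sum_(B : {ffun T -> {ffun 'I_t -> 'I_q.+1}})
                2 ^ zeros (B x - B y + c)%R
   = #|{ffun T -> {ffun 'I_t -> 'I_q.+1}}| * q.+2 ^ t)%N.
Proof.
move=> xy; set S := (\sum_B _)%N.
have shift v : (\sum_(B : {ffun T -> {ffun 'I_t -> 'I_q.+1}})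
    2 ^ zeros (B x - B y + c + v)%R = S)%N.
  pose d : {ffun T -> {ffun 'I_t -> 'I_q.+1}} :=
    [ffun z => if z == x then v else 0].
  rewrite /S [RHS](reindex_inj (addIr d)) /=; apply: eq_bigr => B _.
  congr (2 ^ zeros _)%N.
  by rewrite !ffunE eqxx eq_sym (negbTE xy) addr0 addrAC (addrAC (B x)).
transitivity (\sum_(v : {ffun 'I_t -> 'I_q.+1}) S)%N.
  by rewrite sum_nat_const card_ffun !card_ord.
rewrite -(eq_bigr _ (fun v _ => shift v)) exchange_big /=.
rewrite (eq_bigr (fun=> q.+2 ^ t)%N) ?sum_nat_const // => B _.
by rewrite -sum_exp_zeros [RHS](reindex_inj (addrI (B x - B y + c))).
Qed.

(** * The potential and the successive choice of the maps *)

(** Words grow at their end because branches are extended away from the root, so that the prefix [s]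
    of [rcons s a] keeps its agreements. *)
Fixpoint words (T : finType) (n : nat) : seq (seq T) :=
  if n is n'.+1 then [seq rcons w a | w <- words T n', a <- enum T] else [:: [::]].

Lemma mem_words (T : finType) (w : seq T) : w \in words T (size w).
Proof.
elim/last_ind: w => [|w a IH]; first by rewrite inE.
rewrite size_rcons /=; apply/allpairsP; exists (w, a); split=> //.
by rewrite mem_enum.
Qed.

Lemma size_words (T : finType) n (w : seq T) : w \in words T n -> size w = n.
Proof.
elim: n w => [|n IH] w /=; first by rewrite inE => /eqP->.
by move=> /allpairsP[[u a] [/= /IH <- _ ->]]; rewrite size_rcons.
Qed.

Definition potential (T : finType) (t q : nat)
    (A : nat -> T -> {ffun 'I_t -> 'I_q.+1}) (n : nat) : nat :=
  (\sum_(s <- words (T * T)%type n | pairs_differ s) 2 ^ agreements A s)%N.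

Lemma eq_potential (T : finType) (t q : nat)
    (A B : nat -> T -> {ffun 'I_t -> 'I_q.+1}) n :
  (forall i, (i < n)%N -> A i = B i) -> potential A n = potential B n.
Proof.
move=> AB; rewrite /potential big_seq_cond [RHS]big_seq_cond.
apply: eq_bigr => s /andP[/size_words sn _].
by rewrite (eq_agreements (B := B)) // sn.
Qed.

Lemma le_potential (T : finType) (t q : nat)
    (A : nat -> T -> {ffun 'I_t -> 'I_q.+1}) s :
  pairs_differ s -> (2 ^ agreements A s <= potential A (size s))%N.
Proof.
move=> ds; rewrite /potential (big_rem s) ?mem_words //= ds.
exact: leq_addr.
Qed.

Lemma exists_le_average (I : finType) (F : I -> nat) (a b : nat) :
  (0 < #|I|)%N -> (a * \sum_i F i <= #|I| * b)%N -> exists i, (a * F i <= b)%N.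
Proof.
move=> I0 le; apply: contrapT => /forallNP H.
suff : (#|I| * b < a * \sum_i F i)%N by rewrite ltnNge le.
rewrite big_distrr /= -sum_nat_const.
have [i0 _] := card_gt0P I0.
have H' i : (b < a * F i)%N by rewrite ltnNge; apply/negP/H.
rewrite (bigD1 i0) //= [X in (_ < X)%N](bigD1 i0) //=.
rewrite -addSn leq_add // leq_sum // => i _; exact: ltnW.
Qed.

Definition update (T : Type) (A : nat -> T) (n : nat) (b : T) : nat -> T :=
  fun i => if i == n then b else A i.

Lemma update_lt (T : Type) (A : nat -> T) n b i : (i < n)%N -> update A n b i = A i.
Proof. by move=> /ltn_eqF; rewrite /update => ->. Qed.

(** The agreements of [s] involve only maps of index below [size s], so their weight is constant in
    [B]. The last label difference meets [B] only through the first pair, whose letters differ, and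
    the rest of it is a fixed shift. *)
Lemma sum_exp_agreements_rcons (T : finType) (t q : nat)
    (A : nat -> T -> {ffun 'I_t -> 'I_q.+1}) s a :
  pairs_differ (rcons s a) ->
  (q.+1 ^ t * \sum_(B : {ffun T -> {ffun 'I_t -> 'I_q.+1}})
                2 ^ agreements (update A (size s) B) (rcons s a)
   = 2 ^ agreements A s * (#|{ffun T -> {ffun 'I_t -> 'I_q.+1}}| * q.+2 ^ t))%N.
Proof.
move=> dsa.
(* The first pair [b] is [a] itself when [s] is empty; [size r = size s] makes it the pair that
   meets [B]. *)
have [b [r [er szr db]]] : exists b r,
    [/\ rcons s a = b :: r, size r = size s & b.1 != b.2].
  case: s dsa => [|b s] /= d; [exists a, [::] | exists b, (rcons s a)] => //.
  by rewrite size_rcons.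
rewrite -(sum_exp_zeros_shift (label_diff A r) db) mulnCA [in RHS]big_distrr /=.
congr muln; apply: eq_bigr => B _.
rewrite agreements_rcons er expnD; congr muln.
  by congr expn; apply: eq_agreements => i; exact: update_lt.
rewrite label_diff_cons szr /update eqxx; congr (2 ^ zeros (_ + _)%R)%N.
by apply: eq_label_diff => i; rewrite szr; exact: update_lt.
Qed.

Lemma potential_step (T : finType) (t q : nat)
    (A : nat -> T -> {ffun 'I_t -> 'I_q.+1}) n :
  exists B : T -> {ffun 'I_t -> 'I_q.+1},
    (q.+1 ^ t * potential (update A n B) n.+1
       <= #|T| ^ 2 * q.+2 ^ t * potential A n)%N.
Proof.
suff [B HB] : exists B : {ffun T -> {ffun 'I_t -> 'I_q.+1}},
    (q.+1 ^ t * potential (update A n B) n.+1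
       <= #|T| ^ 2 * q.+2 ^ t * potential A n)%N by exists B.
apply: exists_le_average.
  by apply/card_gt0P; exists [ffun=> 0].
pose F (B : {ffun T -> {ffun 'I_t -> 'I_q.+1}}) s :=
  (if pairs_differ s then 2 ^ agreements (update A n B) s else 0)%N.
pose c := (#|{ffun T -> {ffun 'I_t -> 'I_q.+1}}| * q.+2 ^ t)%N.
pose G s := (if pairs_differ s then 2 ^ agreements A s else 0)%N.
(* This is only an inequality: for empty [s] and [a] on the diagonal, the extension leaves the
   potential. The factor [#|T| ^ 2] will count the choices of [a]. *)
have bound s a : s \in words (T * T)%type n ->
    (q.+1 ^ t * \sum_B F B (rcons s a) <= G s * c)%N.
  move=> /size_words sn; rewrite /F /G.
  have [dsa|_] := boolP (pairs_differ (rcons s a)); last by rewrite big1 ?muln0.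
  by rewrite (pairs_differ_rcons dsa) -sn sum_exp_agreements_rcons.
have -> : (\sum_(B : {ffun T -> _}) potential (update A n B) n.+1 =
    \sum_(s <- words (T * T)%type n) \sum_(a : T * T) \sum_B F B (rcons s a))%N.
  transitivity (\sum_B \sum_(s <- words (T * T)%type n)
                  \sum_(a : T * T) F B (rcons s a))%N.
    apply: eq_bigr => B _; rewrite /potential big_mkcond /= big_allpairs_dep.
    by apply: eq_bigr => s _; rewrite big_enum.
  by rewrite exchange_big; apply: eq_bigr => s _; rewrite exchange_big.
rewrite big_distrr /=.
apply: (@leq_trans (\sum_(s <- words (T * T)%type n) #|T| ^ 2 * (G s * c))%N).
  rewrite big_seq [leqRHS]big_seq; apply: leq_sum => s sn.
  rewrite -[(#|T| ^ 2)%N]/(#|T| * #|T|)%N -card_prod -sum_nat_const big_distrr /=.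
  by apply: leq_sum => a _; exact: bound.
rewrite -big_distrr -big_distrl /= /G -big_mkcond /= -/(potential A n).
by rewrite /c; lia.
Qed.

(** Step [n] changes only the map of index [n], which sequences of length at most [n] never meet.
    Earlier bounds survive, and one family serves all lengths up to [n]. *)
Lemma exists_few_agreements (T : finType) (t q n : nat) :
  exists A : nat -> T -> {ffun 'I_t -> 'I_q.+1}, forall s : seq (T * T),
    pairs_differ s -> (size s <= n)%N ->
    ((q.+1 ^ t) ^ size s * 2 ^ agreements A s
       <= (#|T| ^ 2 * q.+2 ^ t) ^ size s)%N.
Proof.
suff [A HA] : exists A : nat -> T -> {ffun 'I_t -> 'I_q.+1},
    forall m, (m <= n)%N ->
    ((q.+1 ^ t) ^ m * potential A m <= (#|T| ^ 2 * q.+2 ^ t) ^ m)%N.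
  exists A => s ds sn; apply: leq_trans (HA _ sn).
  by rewrite leq_mul2l le_potential ?orbT.
elim: n => [|n [A IH]].
  exists (fun _ _ => 0) => m; rewrite leqn0 => /eqP->.
  by rewrite /potential /= big_cons big_nil /agreements big_ord0.
have [B HB] := potential_step A n; exists (update A n B) => m.
have eqp i : (i <= n)%N -> potential (update A n B) i = potential A i.
  by move=> ni; apply: eq_potential => j ji; apply: update_lt; apply: leq_trans ni.
rewrite leq_eqVlt => /orP[/eqP->|]; last by move=> mn; rewrite eqp // IH.
rewrite (expnS (q.+1 ^ t)) (expnS (#|T| ^ 2 * q.+2 ^ t)) -mulnA mulnCA.
apply: leq_trans (leq_mul (leqnn _) HB) _.
by rewrite mulnCA leq_mul2l IH ?orbT.
Qed.

(** * Paths and distances in the tree *)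

Lemma has_pathP (V : finType) (e : rel V) x y n :
  reflect (exists p, [/\ path e x p, last x p = y & size p = n])
          (has_path_of_length e x y n).
Proof.
apply: (iffP existsP) => [[p /andP[ep /eqP lp]]|[p [ep lp pn]]].
  by exists p; rewrite size_tuple.
by exists (tcast pn (in_tuple p)); rewrite val_tcast ep lp eqxx.
Qed.

Lemma has_path_trans (V : finType) (e : rel V) x y z m n :
  has_path_of_length e x y m -> has_path_of_length e y z n ->
  has_path_of_length e x z (m + n)%N.
Proof.
move=> /has_pathP[p [ep lp <-]] /has_pathP[r [er lr <-]].
by apply/has_pathP; exists (p ++ r); rewrite cat_path last_cat size_cat lp ep er.
Qed.

Lemma has_path_sym (V : finType) (e : rel V) x y n :
  symmetric e -> has_path_of_length e x y n -> has_path_of_length e y x n.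
Proof.
move=> se /has_pathP[p [ep <- <-]]; apply/has_pathP.
exists (rev (belast x p)); split; last by rewrite size_rev size_belast.
  by rewrite rev_path (eq_path (e' := e)).
by case: p {ep} => //= y' p; rewrite rev_cons last_rcons.
Qed.

Lemma path_dist_le (V : finType) (e : rel V) (ec : forall x y, connect e x y) x y n :
  has_path_of_length e x y n -> (path_dist ec x y <= n)%N.
Proof. by rewrite /path_dist; case: ex_minnP => m _; apply. Qed.

Lemma path_distP (V : finType) (e : rel V) (ec : forall x y, connect e x y) x y :
  has_path_of_length e x y (path_dist ec x y).
Proof. by rewrite /path_dist; case: ex_minnP. Qed.

Lemma path_dist_eq0 (V : finType) (e : rel V) (ec : forall x y, connect e x y) x y :
  path_dist ec x y = 0%N -> x = y.
Proof.
move=> d0; have /has_pathP[p [_ lp]] := path_distP ec x y.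
by rewrite d0 => /size0nil p0; rewrite -lp p0.
Qed.

Lemma tree_path_down (k h : nat) (u v : tree k h) w :
  bseqval v = bseqval u ++ w -> has_path_of_length (@tree_adj k h) u v (size w).
Proof.
elim/last_ind: w v => [|w a IH] v.
  by rewrite cats0 => /val_inj->; apply/has_pathP; exists [::].
rewrite -rcons_cat => vE.
have sw : (size (bseqval u ++ w) <= h)%N.
  by apply: leq_trans (size_bseq v); rewrite vE size_rcons.
rewrite size_rcons -addn1; apply: has_path_trans (IH (Bseq sw) erefl) _.
apply/has_pathP; exists [:: v]; split=> //=; rewrite andbT /tree_adj /=.
by apply/orP; left; apply/existsP; exists a; rewrite vE.
Qed.

(** Walk up from [u] to the vertex [p], then down to [v]. *)
Lemma tree_dist_le (k h : nat) (u v : tree k h) p w w' :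
  bseqval u = p ++ w -> bseqval v = p ++ w' ->
  (tree_dist u v <= size w + size w')%N.
Proof.
move=> uE vE; apply: path_dist_le.
have sp : (size p <= h)%N.
  by apply: leq_trans (size_bseq u); rewrite uE size_cat leq_addr.
apply: (@has_path_trans _ _ _ (Bseq sp)); last exact: tree_path_down.
by apply: has_path_sym; [exact: tree_adj_sym | exact: tree_path_down].
Qed.

(** * The l1 distance and a criterion for small distortion *)

Lemma l1_dist_triangle (R : realType) d (x y z : 'rV[R]_d) :
  l1_dist x z <= l1_dist x y + l1_dist y z.
Proof. by rewrite /l1_dist -big_split ler_sum // => i _; exact: ler_distD. Qed.

Lemma l1_dist_refl (R : realType) d (x : 'rV[R]_d) : l1_dist x x = 0.
Proof. by rewrite /l1_dist big1 // => i _; rewrite subrr normr0. Qed.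

Lemma l1_dist_path (R : realType) (V : finType) (e : rel V) d
    (f : V -> 'rV[R]_d) (c : R) x y n :
  (forall u v, e u v -> l1_dist (f u) (f v) <= c) ->
  has_path_of_length e x y n -> l1_dist (f x) (f y) <= c * n%:R.
Proof.
move=> fc /has_pathP[p [ep <- <-]].
elim: p x ep => [|z p IH] x /=; first by rewrite l1_dist_refl mulr0.
move=> /andP[xz zp]; apply: le_trans (l1_dist_triangle _ (f z) _) _.
by rewrite -natr1 mulrDr mulr1 addrC lerD ?IH ?fc.
Qed.

Lemma lip_norm_le (R : realType) (X Y : Type) (dX : X -> X -> R)
    (dY : Y -> Y -> R) (A : set X) (f : X -> Y) (c : R) : 0 <= c ->
  (forall x y, A x -> A y -> x <> y -> dY (f x) (f y) / dX x y <= c) ->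
  (lip_norm dX dY A f <= c%:E)%E.
Proof.
move=> c0 fc; apply: ge_ereal_sup => r [->|[x [y [Ax Ay xy ->]]]];
  by rewrite lee_fin // fc.
Qed.

Lemma lip_norm_ge0 (R : realType) (X Y : Type) (dX : X -> X -> R)
    (dY : Y -> Y -> R) (A : set X) (f : X -> Y) : (0 <= lip_norm dX dY A f)%E.
Proof. by apply: ereal_sup_ubound; left. Qed.

(** In a path metric the upper bound has to be checked on edges only. The lower bound, over all
    pairs, gives both injectivity and the Lipschitz constant [b^-1] of the inverse. *)
Lemma tree_is_embedding (R : realType) (k h d : nat) (f : tree k h -> 'rV[R]_d)
    (b c D : R) : 0 < b -> 0 < c -> c <= b * D ->
  (forall u v, tree_adj u v -> l1_dist (f u) (f v) <= c) ->
  (forall u v, b * (tree_dist u v)%:R <= l1_dist (f u) (f v)) ->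
  is_embedding (fun u v => (tree_dist u v)%:R) (@l1_dist R d) D f.
Proof.
move=> b0 c0 cbD up low.
have dist_gt0 u v : u <> v -> 0 < (tree_dist u v)%:R :> R.
  by move=> uv; rewrite ltr0n lt0n; apply/negP => /eqP/path_dist_eq0.
have l1_gt0 u v : u <> v -> 0 < l1_dist (f u) (f v).
  by move=> /dist_gt0 uv; apply: lt_le_trans (low u v); exact: mulr_gt0.
have finj : injective f.
  move=> u v fuv; apply: contrapT => /l1_gt0.
  by rewrite fuv l1_dist_refl ltxx.
rewrite /is_embedding /distortion; case: asboolP => // _.
apply: (@le_trans _ _ (c%:E * (b^-1)%:E)%E); last first.
  by rewrite -EFinM lee_fin ler_pdivrMr // mulrC.
apply: lee_pmul; rewrite ?lip_norm_ge0 //; apply: lip_norm_le.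
- exact: ltW.
- move=> u v _ _ uv; rewrite ler_pdivrMr ?dist_gt0 //.
  exact: l1_dist_path up (path_distP _ u v).
- by rewrite invr_ge0 ltW.
- move=> _ _ [u _ <-] [v _ <-] fuv.
  have uv : u <> v by move=> uv; apply: fuv; rewrite uv.
  rewrite !pinvKV ?inE //; try by move=> ? ? _ _; exact: finj.
  by rewrite ler_pdivrMr ?l1_gt0 // ler_pdivlMl.
Qed.

(** * One-hot coordinates and distances between images *)

Lemma label_diff_cat_diag (T : Type) (G : zmodType) (A : nat -> T -> G) p s :
  label_diff A ([seq (x, x) | x <- p] ++ s) = label_diff A s.
Proof.
rewrite /label_diff /unzip1 /unzip2 !map_cat -!map_comp /= map_id.
by rewrite label_cat_sub ?size_map.
Qed.

(** Along the common prefix all [t] entries agree at every level; beyond it, label differences do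
    not depend on the prefix. *)
Lemma agreements_cat_diag (T : Type) (t q : nat)
    (A : nat -> T -> {ffun 'I_t -> 'I_q.+1}) p s :
  agreements A ([seq (x, x) | x <- p] ++ s) = (t * size p + agreements A s)%N.
Proof.
elim/last_ind: s => [|s a IH]; last first.
  by rewrite -rcons_cat !agreements_rcons IH rcons_cat label_diff_cat_diag addnA.
rewrite cats0 {2}/agreements big_ord0 addn0.
elim/last_ind: p => [|p x IH]; first by rewrite /agreements big_ord0 muln0.
rewrite map_rcons agreements_rcons IH -map_rcons size_rcons mulnS addnC.
congr addn; rewrite -[X in label_diff A X]cats0 label_diff_cat_diag.
rewrite /label_diff subrr /zeros -[RHS]card_ord; apply: eq_card => b.
by rewrite !inE ffunE eqxx.
Qed.

Lemma zip_cat_diag (T : Type) (p w w' : seq T) :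
  zip (p ++ w) (p ++ w') = [seq (x, x) | x <- p] ++ zip w w'.
Proof. by elim: p => //= x p ->. Qed.

Lemma take_zip (S T : Type) n (u : seq S) (v : seq T) :
  take n (zip u v) = zip (take n u) (take n v).
Proof. by elim: n u v => [|n IH] [|x u] [|y v] //=; rewrite IH. Qed.

Lemma label_diff_zip (T : Type) (G : zmodType) (A : nat -> T -> G) u v :
  size u = size v -> label_diff A (zip u v) = label A u - label A v.
Proof. by move=> uv; rewrite /label_diff unzip1_zip ?unzip2_zip ?uv. Qed.

(** [P] and [Q] tell whether the two vertices reach the level in question; a vertex that does not
    has a zero block there. *)
Lemma sum_dist_onehot (R : realType) (T : finType) (P Q : bool) (a b : T) :
  \sum_g `|(P && (a == g))%:R - (Q && (b == g))%:R| =
    P%:R + Q%:R - 2 * [&& P, Q & a == b]%:R :> R.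
Proof.
have one (c : T) : \sum_g (c == g)%:R = 1 :> R.
  rewrite (bigD1 c) //= eqxx big1 ?addr0 // => g.
  by rewrite eq_sym => /negbTE->.
case: P Q => -[] /=.
- have [<-|ab] := eqVneq a b.
    by rewrite big1 => [|g _]; rewrite ?subrr ?normr0 //= mulr1 subrr.
  rewrite -[X in X + _ - _](one a) -[X in _ + X - _](one b) -big_split /=.
  rewrite mulr0 subr0.
  apply: eq_bigr => g _; have [<-|_] := eqVneq a g.
    by rewrite eq_sym (negbTE ab) subr0 addr0 normr1.
  by rewrite sub0r normrN add0r ger0_norm.
- rewrite mulr0 subr0 addr0 -[RHS](one a); apply: eq_bigr => g _.
  by rewrite subr0 ger0_norm.
- rewrite mulr0 subr0 add0r -[RHS](one b); apply: eq_bigr => g _.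
  by rewrite sub0r normrN ger0_norm.
- by rewrite big1 => [|g _]; rewrite ?subrr ?normr0 //= mulr0 addr0 subrr.
Qed.

Lemma sum_ltn_ord (h n : nat) : (n <= h)%N -> (\sum_(i < h) (i < n) = n)%N.
Proof.
move=> nh; rewrite -big_mkcond -(big_ord_widen _ (fun=> 1%N) nh).
by rewrite sum1_card card_ord.
Qed.

Definition onehot_labels (R : realType) (T : Type) (h t q : nat)
    (A : nat -> T -> {ffun 'I_t -> 'I_q.+1}) (u : seq T)
    (x : 'I_h * 'I_t * 'I_q.+1) : R :=
  let: (i, b, g) := x in ((i < size u)%N && (label A (take i.+1 u) b == g))%:R.

Lemma sum_dist_onehot_labels (R : realType) (T : Type) (h t q : nat)
    (A : nat -> T -> {ffun 'I_t -> 'I_q.+1}) (u v : seq T) :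
  (size u <= h)%N -> (size v <= h)%N ->
  \sum_(x : 'I_h * 'I_t * 'I_q.+1)
     `|onehot_labels R A u x - onehot_labels R A v x| =
  t%:R * (size u + size v)%:R - 2 * (agreements A (zip u v))%:R.
Proof.
move=> uh vh.
pose D (i : 'I_h) (b : 'I_t) (g : 'I_q.+1) : R :=
  `|onehot_labels R A u (i, b, g) - onehot_labels R A v (i, b, g)|.
transitivity (\sum_(i < h) \sum_(b < t) \sum_(g < q.+1) D i b g).
  by rewrite pair_bigA pair_bigA; apply: eq_bigr => -[[i b] g] _.
under eq_bigr => i _ do under eq_bigr => b _ do rewrite /D sum_dist_onehot.
(* [zip] stops at the shorter word, which matches the two tests for levels reached by both
   vertices. *)
have -> : agreements A (zip u v) =
    (\sum_(i < h) \sum_(b < t) [&& (i < size u), (i < size v) &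
       label A (take i.+1 u) b == label A (take i.+1 v) b])%N.
  rewrite /agreements size_zip.
  rewrite (big_ord_widen _ (fun i => zeros (label_diff A (take i.+1 (zip u v))))
    (leq_trans (geq_minl _ _) uh)) big_mkcond; apply: eq_bigr => i _.
  rewrite leq_min; case: ltnP => iu /=; last by rewrite big1.
  case: ltnP => iv /=; last by rewrite big1.
  rewrite take_zip label_diff_zip ?size_takel // /zeros -sum1dep_card big_mkcond /=.
  by apply: eq_bigr => b _; rewrite !ffunE subr_eq0.
under eq_bigr => i _ do rewrite sumrB sumr_const card_ord -mulr_sumr -natr_sum.
rewrite sumrB -mulr_sumr -natr_sum; congr (_ - _).
rewrite sumrMnl -[LHS]mulr_natl; congr (_ * _).
by rewrite big_split /= -!natr_sum !sum_ltn_ord // natrD.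
Qed.

Definition onehot_embedding (R : realType) (k h t q : nat)
    (A : nat -> 'I_k -> {ffun 'I_t -> 'I_q.+1}) (u : tree k h) :
    'rV[R]_#|{: 'I_h * 'I_t * 'I_q.+1}| :=
  \row_j onehot_labels R A (bseqval u) (enum_val j).

(** The prefix [p] adds [2 * t * size p] to the first term and [t * size p] agreements, each
    subtracted twice, so it drops out. *)
Lemma l1_dist_onehot_embedding (R : realType) (k h t q : nat)
    (A : nat -> 'I_k -> {ffun 'I_t -> 'I_q.+1}) (u v : tree k h) p w w' :
  bseqval u = p ++ w -> bseqval v = p ++ w' ->
  l1_dist (onehot_embedding R A u) (onehot_embedding R A v) =
    t%:R * (size w + size w')%:R - 2 * (agreements A (zip w w'))%:R.
Proof.
move=> uE vE; transitivity (\sum_(x : 'I_h * 'I_t * 'I_q.+1)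
    `|onehot_labels R A (bseqval u) x - onehot_labels R A (bseqval v) x|).
  rewrite [RHS](reindex (@enum_val _ (mem {: 'I_h * 'I_t * 'I_q.+1}))) /=;
    last exact/onW_bij/enum_val_bij.
  by apply: eq_bigr => j _; rewrite !mxE.
rewrite sum_dist_onehot_labels ?size_bseq // uE vE zip_cat_diag.
by rewrite agreements_cat_diag !size_cat !natrD natrM; ring.
Qed.

(** * Logarithmic estimates *)

Lemma ln2_ge_half (R : realType) : 2^-1 <= ln 2 :> R.
Proof.
have := @le_ln1Dx R (- 2^-1); rewrite (_ : 1 - 2^-1 = 2^-1 :> R); last by field.
by rewrite lnV ?posrE //; lra.
Qed.

Lemma ln_natSS_sub (R : realType) q :
  ln q.+2%:R - ln q.+1%:R <= q.+1%:R^-1 :> R.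
Proof.
rewrite -ln_div ?posrE //.
have -> : q.+2%:R / q.+1%:R = 1 + q.+1%:R^-1 :> R by rewrite -natr1; field.
by apply: le_ln1Dx; apply: lt_trans (_ : 0 < _); rewrite ?invr_gt0 ?ltrN10.
Qed.

(* Logarithmic form of the potential bound; [ln 2 >= 1 / 2] turns the constants
   16 and 8 into the loss [delta / 2]. *)
Lemma agreements_le (R : realType) (k t q L Z : nat) (delta : R) :
  (1 < k)%N -> 0 < delta -> 16 * ln k%:R <= delta * t%:R -> 8 <= delta * q.+1%:R ->
  ((q.+1 ^ t) ^ L * 2 ^ Z <= (k ^ 2 * q.+2 ^ t) ^ L)%N ->
  2 * Z%:R <= delta * t%:R * L%:R :> R.
Proof.
move=> k1 d0 ht hq; rewrite -(ler_nat R) !natrM !natrX natrM !natrX => le.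
have k0 : 0 < k%:R :> R by rewrite ltr0n; lia.
have q1 : 0 < q.+1%:R :> R by [].
have q2 : 0 < q.+2%:R :> R by [].
move: le; rewrite -[_ <= _]ler_ln ?posrE ?(mulr_gt0, exprn_gt0) //.
rewrite lnM ?posrE ?exprn_gt0 // !lnXn ?(mulr_gt0, exprn_gt0) //.
rewrite lnM ?posrE ?exprn_gt0 // !lnXn //.
rewrite -!(mulr_natl (ln _)) -(mulr_natl (_ * _)) -(mulr_natl (_ + _)) => le.
have Zln : Z%:R * ln 2 <=
    L%:R * (2 * ln k%:R + t%:R * (ln q.+2%:R - ln q.+1%:R)) :> R.
  by lra.
have q8 : q.+1%:R^-1 <= delta / 8 :> R.
  by rewrite -[leLHS]mul1r ler_pdivrMr // mulrAC ler_pdivlMr // mul1r.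
have tq : t%:R * (ln q.+2%:R - ln q.+1%:R) <= t%:R * (delta / 8) :> R.
  by rewrite ler_wpM2l //; apply: le_trans q8; exact: ln_natSS_sub.
have Z2 : Z%:R * 2^-1 <= Z%:R * ln 2 :> R by rewrite ler_wpM2l // ln2_ge_half.
have : L%:R * (2 * ln k%:R + t%:R * (ln q.+2%:R - ln q.+1%:R))
    <= L%:R * (delta * t%:R / 4) :> R by rewrite ler_wpM2l //; lra.
by lra.
Qed.

(** * The embeddings and the choice of parameters *)

Lemma tree_adj_sizes (k h : nat) (u v : tree k h) :
  tree_adj u v -> exists p w w', [/\ bseqval u = p ++ w, bseqval v = p ++ w',
    (size w + size w' = 1)%N & zip w w' = [::]].
Proof.
move=> /orP[] /existsP[a /eqP <-].
  by exists (bseqval u), [::], [:: a]; rewrite cats0 cats1.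
by exists (bseqval v), [:: a], [::]; rewrite cats0 cats1.
Qed.

Lemma exists_onehot_embedding (R : realType) (k h t q : nat) (delta D : R) :
  (1 < k)%N -> (0 < t)%N -> 0 < delta -> 1 <= (1 - delta / 2) * D -> delta < 2 ->
  16 * ln k%:R <= delta * t%:R -> 8 <= delta * q.+1%:R ->
  exists f : tree k h -> 'rV[R]_(h * t * q.+1),
    is_embedding (fun u v => (tree_dist u v)%:R) (@l1_dist R _) D f.
Proof.
move=> k1 t0 d0 dD d2 ht hq.
have <- : #|{: 'I_h * 'I_t * 'I_q.+1}| = (h * t * q.+1)%N.
  by rewrite !card_prod !card_ord.
have [A HA] := exists_few_agreements 'I_k t q h.
exists (onehot_embedding R A).
have t1 : 0 < t%:R :> R by rewrite ltr0n.
have b0 : 0 < 1 - delta / 2 by lra.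
apply: (@tree_is_embedding _ _ _ _ _ (t%:R * (1 - delta / 2)) t%:R).
- exact: mulr_gt0.
- by [].
- by rewrite -mulrA ler_pMr.
- move=> u v /tree_adj_sizes[p [w [w' [uE vE sw zw]]]].
  rewrite (l1_dist_onehot_embedding _ _ uE vE) sw zw mulr1.
  by rewrite lerBlDr lerDl mulr_ge0.
move=> u v; have [p [w [w' [uE vE dw]]]] := common_prefix (bseqval u) (bseqval v).
rewrite (l1_dist_onehot_embedding _ _ uE vE).
have zh : (size (zip w w') <= h)%N.
  rewrite size_zip (leq_trans (geq_minl _ _)) //.
  by apply: leq_trans (size_bseq u); rewrite uE size_cat leq_addl.
have := HA _ dw zh; rewrite card_ord => /(agreements_le k1 d0 ht hq) le.
set N := (size w + size w')%N.
(* The shorter branch has at most half of the total length [N], which turns the loss [delta] per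
   common level into [delta / 2]. *)
have z2 : 2 * (size (zip w w'))%:R <= N%:R :> R.
  by rewrite -natrM ler_nat size_zip /N; lia.
have dN : (tree_dist u v)%:R <= N%:R :> R by rewrite ler_nat (tree_dist_le uE vE).
have := ler_wpM2l (ltW (mulr_gt0 t1 b0)) dN.
have := ler_wpM2l (ltW (mulr_gt0 d0 t1)) z2.
by lra.
Qed.

(** The tree is then a path or a single vertex, and the depth is an isometry. *)
Lemma exists_depth_embedding (R : realType) (k h : nat) (D : R) :
  (k <= 1)%N -> 1 <= D ->
  exists f : tree k h -> 'rV[R]_1,
    is_embedding (fun u v => (tree_dist u v)%:R) (@l1_dist R _) D f.
Proof.
move=> k1 D1; exists (fun u => const_mx (size (bseqval u))%:R).
have l1E (u v : tree k h) p w w' : bseqval u = p ++ w -> bseqval v = p ++ w' ->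
    zip w w' = [::] -> l1_dist (const_mx (size (bseqval u))%:R : 'rV[R]_1)
      (const_mx (size (bseqval v))%:R) = (size w + size w')%:R.
  move=> -> ->; rewrite /l1_dist big_ord1 !mxE !size_cat !natrD.
  case: w w' => [|x w] [|y w'] //= _; rewrite opprD addrACA subrr add0r.
  - by rewrite subrr normr0 addr0.
  - by rewrite sub0r normrN add0r ger0_norm.
  - by rewrite subr0 addr0 ger0_norm.
apply: (@tree_is_embedding _ _ _ _ _ 1 1) => //; first by rewrite mul1r.
  move=> u v /tree_adj_sizes[p [w [w' [uE vE sw zw]]]].
  by rewrite (l1E _ _ _ _ _ uE vE zw) sw.
move=> u v; have [p [w [w' [uE vE dw]]]] := common_prefix (bseqval u) (bseqval v).
rewrite mul1r (l1E _ _ _ _ _ uE vE) ?ler_nat ?(tree_dist_le uE vE) //.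
(* Two nonempty branches would start with distinct letters, but ['I_k] has at most one element. *)
case: w w' dw {uE vE} => [|x w] [|y w'] //= /negP[]; apply/eqP/val_inj => /=.
by have := ltn_ord x; have := ltn_ord y; lia.
Qed.

Theorem theorem2p1 (R : realType) :
  exists C : R, 0 < C /\
    forall (k h : nat) (eps : R), 0 < eps ->
      exists (d : nat) (f : tree k h -> 'rV[R]_d),
        d%:R <= dim_bound C k h eps /\
        is_embedding (fun u v => (tree_dist u v)%:R) (@l1_dist R d)
          (1 + eps) f.
Proof.
(* [162 = 18 * 9] is the product of the constants in [tle] and [qle]. *)
exists 162; split=> // k h eps eps0; rewrite /dim_bound.
have [k1|k1] := leqP k 1.
  have [|f fE] := @exists_depth_embedding R k h (1 + eps) k1; first by lra.
  by exists 1%N, f; split=> //; rewrite le_max lexx.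
set delta := Num.min 1 eps.
have d0 : 0 < delta by rewrite lt_min eps0 ltr01.
have d1 : delta <= 1 by rewrite ge_min lexx.
have deps : delta <= eps by rewrite ge_min lexx orbT.
have lnk : 2^-1 <= ln k%:R :> R.
  apply: le_trans (ln2_ge_half R) _.
  by rewrite ler_ln ?posrE ?ltr0n ?ler_nat //; lia.
(* [x] and [y] are the smallest real values allowed for [t] and [q.+1]; both are rounded up by
   truncation plus one. *)
set x := 16 * ln k%:R / delta; set y := 8 / delta.
have x0 : 0 <= x by rewrite divr_ge0 ?ltW //; lra.
have y0 : 0 <= y by rewrite divr_ge0 ?ltW.
have /andP[tx xt] := truncn_itv x0; have /andP[qy yq] := truncn_itv y0.
have [||||f fE] := @exists_onehot_embedding R k h (Num.truncn x).+1 (Num.truncn y)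
  delta (1 + eps) k1 isT d0.
(* The product is [1 + delta * (1 - delta) / 2], at least 1 since [delta <= 1]. *)
- apply: le_trans (_ : (1 - delta / 2) * (1 + delta) <= _); last first.
    by rewrite ler_wpM2l; lra.
  by nra.
- by lra.
- by rewrite -ler_pdivrMl // mulrC ltW.
- by rewrite -ler_pdivrMl // mulrC ltW.
exists (h * (Num.truncn x).+1 * (Num.truncn y).+1)%N, f; split=> //.
rewrite le_max; apply/orP; right.
have dV : 1 <= delta^-1 by rewrite invf_ge1.
(* Rounding costs at most 1, absorbed by [1 <= 2 * ln k / delta] here (16 becomes 18) and by
   [1 <= 1 / delta] in [qle] (8 becomes 9). *)
have tle : (Num.truncn x).+1%:R <= 18 * (ln k%:R / delta).
  rewrite -natr1; have : 2^-1 * 1 <= ln k%:R * delta^-1 by apply: ler_pM => //; lra.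
  by rewrite /x in tx *; lra.
have qle : (Num.truncn y).+1%:R <= 9 / delta.
  by rewrite -natr1; rewrite /y in qy *; lra.
rewrite !natrM -mulrA.
have -> : 162 * (h%:R * ln k%:R / delta ^+ 2) =
    h%:R * (18 * (ln k%:R / delta) * (9 / delta)) by field; rewrite gt_eqF.
by rewrite ler_wpM2l // ler_pM.
Qed.
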